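(* Fix $0\le k<n$. Define $\phi$ on two-step flag positroids $(P,Q)$ on $[n]$ with $\mathrm{rank}\,P=k$, $\mathrm{rank}\,Q=k+1$ by letting $\phi(P,Q)$ be the matroid $R$ on $[0,n]=\{0,1,\dots,n\}$ with set of bases $\{B\cup\{0\}: B\text{ a basis of }P\}\cup\{B: B\text{ a basis of }Q\}$. Define $\psi$ on $\mathcal R_{k+1}([0,n])$ by $\psi(R)=(P,Q)$, where the bases of $P$ are $\{B\setminus\{0\}: B\text{ a basis of }R,\ 0\in B\}$ and the bases of $Q$ are $\{B: B\text{ a basis of }R,\ 0\notin B\}$. Then $\phi$ and $\psi$ are well-defined, mutually inverse bijections between the set $\mathcal P_{(k,k+1)}([n])$ of such two-step flag positroids and the set $\mathcal R_{k+1}([0,n])$.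
   Context: A positroid of rank $r$ on a totally ordered ground set $E=\{e_1<\dots<e_m\}$ is a matroid whose bases are the $r$-subsets $S$ of $E$ with $\Delta_S(M)\ne0$ for some real $r\times m$ matrix $M$ (columns indexed by $E$ in order) all of whose maximal minors are nonnegative. A two-step flag positroid $(P,Q)$ on $[n]$ of ranks $(k,k+1)$ is a pair of matroids on $[n]$ for which there is a real $(k+1)\times n$ matrix $A$ such that the submatrix of the first $k$ rows realizes $P$ (its nonzero maximal minors are indexed exactly by the bases of $P$) and $A$ realizes $Q$, and all maximal minors of the first-$k$-rows submatrix and all maximal minors of $A$ are nonnegative. $\mathcal P_{(k,k+1)}([n])$ denotes the set of these. The ground set $[0,n]$ is ordered $0<1<\dots<n$. For a positroid $R$ on $[0,n]$, $S(R)$ is its lexicographically minimal basis and $T(R)$ its lexicographically minimal basis not containing $0$ ($T(R)=\emptyset$ if every basis contains $0$). $\mathcal R_{k+1}([0,n])$ is the set of rank $k+1$ positroids $R$ on $[0,n]$ with $0\in S(R)$ and $T(R)\ne\emptyset$. *)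

(* Defs.v *)
From mathcomp Require Import classical_sets functions reals.
From mathcomp Require Import all_boot all_order all_algebra.

Set Implicit Arguments.
Unset Strict Implicit.
Unset Printing Implicit Defensive.

Import Order.TTheory GRing.Theory Num.Theory.
Local Open Scope ring_scope.

(* Conventions: a matroid is represented by its set of bases.  An ordered ground
   set with m elements is 'I_m: the set [n] = {1, ..., n} is 'I_n (i stands for
   i + 1) and [0,n] is 'I_n.+1, so that the inclusion of [n] into [0,n] is
   lift ord0. *)

Definition is_matroid (T : finType) (P : {set {set T}}) : Prop :=
  P != set0 /\
  forall B1 B2 x, B1 \in P -> B2 \in P -> x \in B1 :\: B2 ->
    exists2 y, y \in B2 :\: B1 & y |: (B1 :\ x) \in P.

Section Positroids.
Variable R : realType.

(* enum_val lists the elements of S : {set 'I_m} in increasing order. *)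
Definition maxminor (r m : nat) (M : 'M[R]_(r, m)) (S : {set 'I_m})
    (hS : #|S| = r) : R :=
  \det (colsub (fun j : 'I_r => enum_val (cast_ord (esym hS) j)) M).

Definition nonneg_maxminors (r m : nat) (M : 'M[R]_(r, m)) : Prop :=
  forall (S : {set 'I_m}) (hS : #|S| = r), 0 <= maxminor M hS.

Definition realizes (r m : nat) (M : 'M[R]_(r, m)) (P : {set {set 'I_m}}) :
    Prop :=
  forall S : {set 'I_m},
    S \in P <-> exists hS : #|S| = r, maxminor M hS != 0.

Definition positroid (r m : nat) (P : {set {set 'I_m}}) : Prop :=
  is_matroid P /\
  exists M : 'M[R]_(r, m), nonneg_maxminors M /\ realizes M P.

Definition first_rows (k n : nat) (A : 'M[R]_(k.+1, n)) : 'M[R]_(k, n) :=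
  rowsub (widen_ord (leqnSn k)) A.

Definition flag_positroids (k n : nat) :
    set ({set {set 'I_n}} * {set {set 'I_n}}) :=
  fun PQ =>
    [/\ is_matroid PQ.1, is_matroid PQ.2 &
      exists A : 'M[R]_(k.+1, n),
        [/\ realizes (first_rows A) PQ.1, realizes A PQ.2,
            nonneg_maxminors (first_rows A) & nonneg_maxminors A]].

Definition lexle (m : nat) (A B : {set 'I_m}) : bool :=
  (enum A <= enum B :> seqlexi 'I_m)%O.

(* The lexicographically minimal member of F, or the empty set if F is empty. *)
Definition lexmin (m : nat) (F : {set {set 'I_m}}) : {set 'I_m} :=
  odflt set0 [pick A in F | [forall B in F, lexle A B]].

Definition S_basis (n : nat) (P : {set {set 'I_n.+1}}) : {set 'I_n.+1} :=
  lexmin P.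

Definition T_basis (n : nat) (P : {set {set 'I_n.+1}}) : {set 'I_n.+1} :=
  lexmin [set B in P | ord0 \notin B].

(* positroids_ST r n is the set R_r([0,n]). *)
Definition positroids_ST (r n : nat) : set {set {set 'I_n.+1}} :=
  fun P => [/\ positroid r P, ord0 \in S_basis P & T_basis P != set0].

End Positroids.

Definition phi (n : nat) (PQ : {set {set 'I_n}} * {set {set 'I_n}}) :
    {set {set 'I_n.+1}} :=
  [set ord0 |: (lift ord0 @: B) | B : {set 'I_n} in PQ.1] :|:
  [set lift ord0 @: B | B : {set 'I_n} in PQ.2].

Definition psi (n : nat) (P : {set {set 'I_n.+1}}) :
    {set {set 'I_n}} * {set {set 'I_n}} :=
  ([set lift ord0 @^-1: (B :\ ord0) | B : {set 'I_n.+1} in P & ord0 \in B],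
   [set lift ord0 @^-1: B | B : {set 'I_n.+1} in P & ord0 \notin B]).

Arguments flag_positroids : clear implicits.
Arguments positroids_ST : clear implicits.

(* Main.v *)
Require Import Defs.
From mathcomp Require Import classical_sets functions reals.
From mathcomp Require Import all_boot all_order all_algebra.

(* Prepend to [A] the column [(-1) ^+ k e_(k+1)]: expanding along it, the maximal
   minors using the column [0] are those of the first [k] rows of [A], and the
   others are those of [A].  This turns a flag positroid into a positroid on
   [0,n] in which [0] is neither a loop nor a coloop, which is what the conditions
   on [S] and [T] say.  Conversely, if [0] is not a loop, multiplying a realization
   on the left by the inverse of a basis submatrix containing the column [0]
   (whose determinant is positive) brings it to this form, up to a cyclic shift
   of the rows. *)

Set Implicit Arguments.
Unset Strict Implicit.
Unset Printing Implicit Defensive.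

Import Order.TTheory GRing.Theory Num.Theory.
Local Open Scope ring_scope.

(** * Enumeration of subsets of $[0,n]$ and evaluation of maximal minors *)

Lemma ord0_lift n (B : {set 'I_n}) : ord0 \notin lift ord0 @: B.
Proof. by apply/imsetP => -[i _ /eqP]; rewrite (negbTE (neq_lift _ _)). Qed.

Lemma enum_lift n (B : {set 'I_n}) :
  enum (lift ord0 @: B) = [seq lift ord0 i | i <- enum B].
Proof.
rewrite /enum_mem -!enumT enum_ordSl /= (negbTE (ord0_lift B)) filter_map.
by congr map; apply: eq_filter => i /=; rewrite mem_imset //; apply: lift_inj.
Qed.

Lemma enum_cons_lift n (B : {set 'I_n}) :
  enum (ord0 |: (lift ord0 @: B)) = ord0 :: [seq lift ord0 i | i <- enum B].
Proof.
rewrite /enum_mem -!enumT enum_ordSl /= setU11 filter_map.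
congr (_ :: map _ _); apply: eq_filter => i /=.
by rewrite in_setU1 eq_sym (negbTE (neq_lift _ _)) mem_imset //; apply: lift_inj.
Qed.

Lemma map_enum_val m r (S : {set 'I_m}) (hS : #|S| = r) :
  [seq enum_val (cast_ord (esym hS) j) | j <- enum 'I_r] = enum S.
Proof.
case: r / hS; rewrite -[RHS](map_tnth_enum (enum_tuple S)).
apply: eq_map => i; rewrite cast_ord_id (enum_val_nth (enum_default i)).
exact/esym/tnth_nth.
Qed.

(** Two column selections that agree as lists agree pointwise. A minor can thus be computed with
    whichever increasing listing [f] of [S] suits a Laplace expansion. *)
Lemma maxminor_colsub (R : realType) m r (M : 'M[R]_(r, m)) (S : {set 'I_m})
    (hS : #|S| = r) (f : 'I_r -> 'I_m) :
  map f (enum 'I_r) = enum S -> maxminor M hS = \det (colsub f M).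
Proof.
move=> fE; congr (\det _); apply/matrixP => i j; rewrite !mxE; congr (M i _).
have /eq_in_map : map (fun j => enum_val (cast_ord (esym hS) j)) (enum 'I_r) =
                  map f (enum 'I_r) by rewrite map_enum_val.
by apply; rewrite mem_enum.
Qed.

Lemma maxminor_mulmx (R : realType) m r (g : 'M[R]_r) (M : 'M[R]_(r, m))
    (S : {set 'I_m}) (hS : #|S| = r) :
  maxminor (g *m M) hS = \det g * maxminor M hS.
Proof. by rewrite /maxminor -mulmx_colsub det_mulmx. Qed.

Lemma card_lift n (B : {set 'I_n}) : #|lift ord0 @: B| = #|B|.
Proof. by rewrite card_imset //; apply: lift_inj. Qed.

Lemma card_cons_lift n (B : {set 'I_n}) : #|ord0 |: (lift ord0 @: B)| = #|B|.+1.
Proof. by rewrite cardE enum_cons_lift /= size_map -cardE. Qed.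

(** * Basis exchange for the columns of a matrix *)

Section Exchange.
Variables (R : realType) (r m : nat) (M : 'M[R]_(r, m)).

(** Matrices encode subspaces by their row spaces, so the columns of [M] enter as rows of [M^T]. *)
Definition colspan (S : {set 'I_m}) : 'M[R]_r := (\sum_(i in S) <<row i M^T>>)%MS.

Lemma row_colspan (S : {set 'I_m}) i : i \in S -> (row i M^T <= colspan S)%MS.
Proof. by move=> iS; apply: (sumsmx_sup i); rewrite ?genmxE. Qed.

Lemma colspan_subP k (S : {set 'I_m}) (A : 'M[R]_(k, r)) :
  reflect (forall i, i \in S -> (row i M^T <= A)%MS) (colspan S <= A)%MS.
Proof.
by apply: (iffP sumsmx_subP) => h i iS; move: (h i iS); rewrite genmxE.
Qed.

(** The transposed submatrix has row space [colspan S], and a square matrix is invertible exactly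
    when it has full rank. *)
Lemma maxminor_neq0 (S : {set 'I_m}) (hS : #|S| = r) :
  (maxminor M hS != 0) = (\rank (colspan S) == r).
Proof.
pose f j := enum_val (cast_ord (esym hS) j).
rewrite -[maxminor M hS]/(\det (colsub f M)) -det_tr -unitfE.
rewrite -[_ \is a _]/(_ \in unitmx) -row_full_unit.
rewrite /row_full; congr (_ == _).
apply/eqP; rewrite eqn_leq; apply/andP; split; apply: mxrankS.
  apply/row_subP => j.
  have -> : row j (colsub f M)^T = row (f j) M^T by apply/rowP => i; rewrite !mxE.
  by apply: row_colspan; apply: enum_valP.
apply/colspan_subP => i iS.
have -> : row i M^T = row (cast_ord hS (enum_rank_in iS i)) (colsub f M)^T.
  by apply/rowP => j; rewrite !mxE /f cast_ordK enum_rankK_in.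
exact: row_sub.
Qed.

Lemma realizes_rank P (S : {set 'I_m}) : realizes M P ->
  S \in P <-> #|S| = r /\ \rank (colspan S) = r.
Proof.
move=> MP; rewrite (MP S); split=> [[hS]|[hS rS]].
  by rewrite maxminor_neq0 => /eqP.
by exists hS; rewrite maxminor_neq0 rS.
Qed.

(* If no column in [B2] extends the columns of [B1 :\ x] to a basis, then they
   all lie in the span of the latter, whose dimension is too small. *)
Lemma realizes_matroid P : realizes M P -> P != set0 -> is_matroid P.
Proof.
move=> MP P0; split=> // B1 B2 x /(realizes_rank _ MP) [cB1 rB1].
move=> /(realizes_rank _ MP) [_ rB2] /setDP [xB1 xB2].
have cB1x : #|B1 :\ x|.+1 = r by rewrite -cB1 (cardsD1 x B1) xB1.
(* A sum of [#|S|] spaces, each of rank at most 1. *)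
have rkS S : (\rank (colspan S) <= #|S|)%N.
  rewrite -sum1_card; apply: (big_ind2 (fun (A : 'M_r) d => \rank A <= d)%N).
  - by rewrite mxrank0.
  - move=> A d A' d' Ad Ad'; apply: leq_trans (mxrank_adds_leqif _ _) _.
    exact: leq_add.
  - by move=> i _; rewrite genmxE rank_leq_row.
have [y yB2 yV] : exists2 y, y \in B2 & ~~ (row y M^T <= colspan (B1 :\ x))%MS.
  apply/exists_inP; rewrite -negb_forall_in; apply/forall_inP => /colspan_subP.
  by move=> /mxrankS; rewrite rB2 => /leq_trans/(_ (rkS _)); rewrite -cB1x ltnn.
have yB1 : y \notin B1.
  apply: contra yV => yB1; apply: row_colspan; rewrite in_setD1 yB1 andbT.
  by apply: contraNneq xB2 => <-.
exists y; first by rewrite in_setD yB1.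
apply/(realizes_rank _ MP); split.
  by rewrite cardsU1 in_setD1 (negbTE yB1) andbF.
apply/eqP; rewrite eqn_leq rank_leq_row /=.
(* Restoring the column [x] brings the rank back to [r], so its removal lost at most 1. *)
have rx : (r <= \rank (colspan (B1 :\ x)) + 1)%N.
  apply: (@leq_trans (\rank (colspan (B1 :\ x) + row x M^T)%MS)).
    rewrite -[leqLHS]rB1; apply/mxrankS/colspan_subP => i iB1.
    have [->|ix] := eqVneq i x.
      exact: addsmxSr.
    by apply: submx_trans (addsmxSl _ _); apply: row_colspan; rewrite !inE ix.
  apply: leq_trans (mxrank_adds_leqif _ _) _.
  by rewrite leq_add2l rank_leq_row.
(* The column [y] lies outside the span, so adding it raises the rank strictly. *)
apply: leq_trans rx _; rewrite addn1; apply: rank_ltmx.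
have sub : (colspan (B1 :\ x) <= colspan (y |: (B1 :\ x)))%MS.
  by apply/colspan_subP => i iB; apply: row_colspan; rewrite in_setU1 iB orbT.
rewrite ltmxE sub; apply: contra yV; apply: submx_trans.
by apply: row_colspan; rewrite setU11.
Qed.

End Exchange.

(** * Lexicographically minimal sets *)

Section LexMin.
Variable m : nat.
Implicit Types F : {set {set 'I_m}}.

Lemma lexminP F : F != set0 ->
  lexmin F \in F /\ forall B, B \in F -> lexle (lexmin F) B.
Proof.
case/set0Pn => A0 A0F; rewrite /lexmin; case: pickP => [A /andP[AF /forall_inP]|] //.
(* A minimiser for the total lexicographic order would have been found by [pick], so the default
   [set0] does not arise. *)
case: (@arg_minP _ (seqlexi 'I_m) _ A0 (mem F) (fun B => enum B) A0F) => A AF Amin.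
by move=> /(_ A) /negP[]; apply/andP; split=> //; apply/forall_inP.
Qed.

Lemma lexmin0 : lexmin (@set0 {set 'I_m}) = set0.
Proof. by rewrite /lexmin; case: pickP => // A; rewrite inE. Qed.

End LexMin.

(** As 0 is the least element, [enum B] starts with it, and the head of [enum A] is at most 0. The
    empty list precedes every list, hence the condition on [A]. *)
Lemma lexle_ord0 n (A B : {set 'I_n.+1}) :
  lexle A B -> ord0 \in B -> A != set0 -> ord0 \in A.
Proof.
rewrite /lexle => AB B0 /set0Pn [a].
have : enum B = ord0 :: [seq i <- map (lift ord0) (enum 'I_n) | i \in B].
  by rewrite {1}/enum_mem -enumT enum_ordSl /= B0.
rewrite -(mem_enum A) -(mem_enum A ord0) => BE; move: AB; rewrite BE.
case: (enum A) => // b s /lexi_lehead; rewrite leEord leqn0 => /eqP b0 _.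
by rewrite (_ : b = ord0) ?mem_head //; apply: val_inj.
Qed.

(** * [phi] and [psi] as inverse maps on families of sets, split by membership of 0 *)

Section Sets.
Variable n : nat.
Implicit Types (B : {set 'I_n}) (S : {set 'I_n.+1}).

Lemma preim_lift B : lift ord0 @^-1: (lift ord0 @: B) = B.
Proof. by apply/setP => i; rewrite inE mem_imset //; apply: lift_inj. Qed.

Lemma setU1_lift S : ord0 \in S ->
  ord0 |: (lift ord0 @: (lift ord0 @^-1: (S :\ ord0))) = S.
Proof.
move=> S0; apply/setP => i; rewrite in_setU1; case: (unliftP ord0 i) => [j|] ->.
  by rewrite eq_sym (negbTE (neq_lift _ _)) mem_imset ?inE //; apply: lift_inj.
by rewrite eqxx S0.
Qed.

Lemma lift_preim S : ord0 \notin S -> lift ord0 @: (lift ord0 @^-1: S) = S.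
Proof.
move=> S0; apply/setP => i; case: (unliftP ord0 i) => [j|] ->.
  by rewrite mem_imset ?inE //; apply: lift_inj.
by rewrite (negbTE S0) (negbTE (ord0_lift _)).
Qed.

Lemma setU1_lift_inj : injective (fun B => ord0 |: (lift ord0 @: B)).
Proof.
move=> B1 B2 /(congr1 (fun S => lift ord0 @^-1: (S :\ ord0))).
by rewrite !setU1K ?ord0_lift // !preim_lift.
Qed.

Lemma phi1 PQ B : (ord0 |: (lift ord0 @: B) \in phi PQ) = (B \in PQ.1).
Proof.
rewrite in_setU (mem_imset _ _ setU1_lift_inj) orbC; case: imsetP => //.
by case=> C _ BC; move: (ord0_lift C); rewrite -BC setU11.
Qed.

Lemma phi2 PQ B : (lift ord0 @: B \in phi PQ) = (B \in PQ.2).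
Proof.
rewrite in_setU mem_imset; last by apply: imset_inj; apply: lift_inj.
by case: imsetP => // -[C _ BC]; move: (ord0_lift B); rewrite BC setU11.
Qed.

Lemma psi1 P B : (B \in (psi P).1) = (ord0 |: (lift ord0 @: B) \in P).
Proof.
apply/imsetP/idP => [[S /setIdP[SP S0] ->]|BP]; first by rewrite setU1_lift.
by exists (ord0 |: (lift ord0 @: B));
  rewrite ?inE ?BP ?setU1K ?ord0_lift ?preim_lift.
Qed.

Lemma psi2 P B : (B \in (psi P).2) = (lift ord0 @: B \in P).
Proof.
apply/imsetP/idP => [[S /setIdP[SP S0] ->]|BP]; first by rewrite lift_preim.
by exists (lift ord0 @: B); rewrite ?inE ?BP ?ord0_lift ?preim_lift.
Qed.

Lemma phiK : cancel (@phi n) (@psi n).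
Proof.
case=> P Q; rewrite [LHS]surjective_pairing.
by congr (_, _); apply/setP => B; rewrite ?psi1 ?psi2 ?phi1 ?phi2.
Qed.

Lemma psiK : cancel (@psi n) (@phi n).
Proof.
move=> P; apply/setP => S; have [S0|S0] := boolP (ord0 \in S).
  by rewrite -(setU1_lift S0) phi1 psi1.
by rewrite -(lift_preim S0) phi2 psi2.
Qed.

End Sets.

(** * Maximal minors of the homogenized matrix *)

Section Correspondence.
Variables (R : realType) (k n : nat).

(* [homog A] is [(e_1 | A')], where [A'] is [A] with its last row moved to the
   top and multiplied by the sign [(-1) ^+ k] of this cyclic shift. *)
Definition homog (A : 'M[R]_(k.+1, n)) : 'M[R]_(k.+1, n.+1) :=
  \matrix_(i, j) match unlift ord0 i, unlift ord0 j with
    | None, None => 1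
    | Some _, None => 0
    | None, Some j => (-1) ^+ k * A ord_max j
    | Some i, Some j => A (widen_ord (leqnSn k) i) j
    end.

(** Drops column 0 and undoes the cyclic shift: row 0 returns to the last place with the same sign,
    since $(-1)^k$ is its own inverse. *)
Definition dehomog (C : 'M[R]_(k.+1, n.+1)) : 'M[R]_(k.+1, n) :=
  \matrix_(i, j) match unlift ord_max i with
    | Some i => C (lift ord0 i) (lift ord0 j)
    | None => (-1) ^+ k * C ord0 (lift ord0 j)
    end.

Lemma widen_lift_max (i : 'I_k) : widen_ord (leqnSn k) i = lift ord_max i.
Proof. by apply: val_inj; rewrite /= /bump leqNgt ltn_ord. Qed.

Lemma dehomogK (C : 'M[R]_(k.+1, n.+1)) :
  (forall i, C i ord0 = (i == ord0)%:R) -> homog (dehomog C) = C.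
Proof.
move=> C0; apply/matrixP => i j; rewrite mxE.
case: (unliftP ord0 i) => [i'|] ->; case: (unliftP ord0 j) => [j'|] ->.
- by rewrite mxE widen_lift_max liftK.
- by rewrite C0 eq_sym (negbTE (neq_lift _ _)).
- by rewrite mxE unlift_none mulrA -expr2 sqrr_sign mul1r.
- by rewrite C0 eqxx.
Qed.

Variable A : 'M[R]_(k.+1, n).

(** Column 0 is $e_1$, so expansion along it leaves a single cofactor, of sign $+1$, and deleting
    row 0 leaves the first [k] rows of [A]. *)
Lemma maxminor_homog0 (B : {set 'I_n}) (hB : #|B| = k)
    (hB0 : #|ord0 |: (lift ord0 @: B)| = k.+1) :
  maxminor (homog A) hB0 = maxminor (first_rows A) hB.
Proof.
pose e j := enum_val (cast_ord (esym hB) j).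
pose f (j : 'I_k.+1) := if unlift ord0 j is Some j' then lift ord0 (e j') else ord0.
rewrite (@maxminor_colsub _ _ _ _ _ _ f); last first.
  rewrite enum_cons_lift enum_ordSl /= {1}/f unlift_none -(map_enum_val hB).
  by rewrite -!map_comp; congr (_ :: _); apply: eq_map => j; rewrite /= /f liftK.
rewrite (expand_det_col _ ord0) big_ord_recl big1 => [|i _]; last first.
  by rewrite !mxE /f liftK unlift_none /= unlift_none mul0r.
rewrite addr0 !mxE /f unlift_none /= unlift_none mul1r /cofactor addn0 expr0 mul1r.
rewrite /maxminor; congr (\det _); apply/matrixP => i j.
by rewrite !mxE /f !liftK.
Qed.

(** Expand the left side along row 0 and the right side along the last row: the complementary minors
    coincide, and the factor $(-1)^k$ in row 0 turns the sign $(-1)^j$ into $(-1)^{k+j}$. *)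
Lemma maxminor_homog (B : {set 'I_n}) (hB : #|B| = k.+1)
    (hB0 : #|lift ord0 @: B| = k.+1) :
  maxminor (homog A) hB0 = maxminor A hB.
Proof.
pose e j := enum_val (cast_ord (esym hB) j).
rewrite (@maxminor_colsub _ _ _ _ _ _ (lift ord0 \o e)); last first.
  by rewrite enum_lift map_comp map_enum_val.
rewrite /maxminor (expand_det_row _ ord0) (expand_det_row _ ord_max).
apply: eq_bigr => j _; rewrite !mxE unlift_none /= liftK /cofactor add0n exprD.
rewrite -!mulrA mulrCA; congr (_ * (_ * (_ * \det _))); apply/matrixP => i l.
by rewrite !mxE /= !liftK widen_lift_max.
Qed.

(** Every subset of $[0,n]$ is $B$ or $\{0\}\cup B$ with $B\subseteq[n]$, and each case has its
    minor formula. *)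
Lemma nonneg_homog : nonneg_maxminors (homog A) <->
  nonneg_maxminors (first_rows A) /\ nonneg_maxminors A.
Proof.
split=> [C0|[A0 A1] S hS].
  split=> B hB.
    have hB0 : #|ord0 |: (lift ord0 @: B)| = k.+1 by rewrite card_cons_lift hB.
    by rewrite -(maxminor_homog0 hB hB0).
  have hB0 : #|lift ord0 @: B| = k.+1 by rewrite card_lift hB.
  by rewrite -(maxminor_homog hB hB0).
have [S0|S0] := boolP (ord0 \in S).
  move: hS; rewrite -(setU1_lift S0) => hS; have := hS.
  by rewrite card_cons_lift => -[hB]; rewrite (maxminor_homog0 hB).
move: hS; rewrite -(lift_preim S0) => hS; have := hS.
by rewrite card_lift => hB; rewrite (maxminor_homog hB).
Qed.

Lemma realizes_homog P : realizes (homog A) P <->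
  realizes (first_rows A) (psi P).1 /\ realizes A (psi P).2.
Proof.
have cons_lift (B : {set 'I_n}) : (exists hS : #|ord0 |: (lift ord0 @: B)| = k.+1,
    maxminor (homog A) hS != 0) <->
    exists hB : #|B| = k, maxminor (first_rows A) hB != 0.
  split=> [[hS]|[hB nz]].
    have := hS; rewrite card_cons_lift => -[hB].
    by rewrite (maxminor_homog0 hB); exists hB.
  have hS : #|ord0 |: (lift ord0 @: B)| = k.+1 by rewrite card_cons_lift hB.
  by exists hS; rewrite (maxminor_homog0 hB).
have just_lift (B : {set 'I_n}) : (exists hS : #|lift ord0 @: B| = k.+1,
    maxminor (homog A) hS != 0) <->
    exists hB : #|B| = k.+1, maxminor A hB != 0.
  split=> [[hS]|[hB nz]].
    have := hS; rewrite card_lift => hB.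
    by rewrite (maxminor_homog hB); exists hB.
  have hS : #|lift ord0 @: B| = k.+1 by rewrite card_lift hB.
  by exists hS; rewrite (maxminor_homog hB).
split=> [CP|[AP AQ] S].
  split=> B; first by rewrite psi1 CP.
  by rewrite psi2 CP.
have [S0|S0] := boolP (ord0 \in S).
  by rewrite -(setU1_lift S0) -psi1 AP cons_lift.
by rewrite -(lift_preim S0) -psi2 AQ just_lift.
Qed.

End Correspondence.

(** * Normalization of a realization, and the two maps *)

Lemma realizes_mulmx (R : realType) r m (g : 'M[R]_r) (M : 'M[R]_(r, m)) P :
  \det g != 0 -> realizes M P -> realizes (g *m M) P.
Proof.
move=> g0 MP S; rewrite MP; split=> -[hS nz]; exists hS; move: nz;
  by rewrite maxminor_mulmx mulf_eq0 (negbTE g0).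
Qed.

(** Left multiplication by [invmx G] turns the columns in [B] into the identity. As [\det G] is a
    nonnegative, nonzero minor, all maximal minors are scaled by the same positive factor. *)
Lemma positroid_normalize (R : realType) k n (M : 'M[R]_(k.+1, n.+1)) P
    (B : {set 'I_n.+1}) :
  nonneg_maxminors M -> realizes M P -> B \in P -> ord0 \in B ->
  exists C : 'M[R]_(k.+1, n.+1),
    [/\ nonneg_maxminors C, realizes C P &
        forall i, C i ord0 = (i == ord0)%:R].
Proof.
move=> M0 MP BP B0; have [hB nz] := (MP B).1 BP.
pose e := fun j => enum_val (cast_ord (esym hB) j); pose G := colsub e M.
have uG : G \in unitmx by rewrite unitmxE unitfE.
(* The least element of [B] is 0, so it is listed first and its column becomes $e_1$. *)
have e0 : e ord0 = ord0.
  have : map e (enum 'I_k.+1) = enum B := map_enum_val hB.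
  by rewrite enum_ordSl /= -(setU1_lift B0) enum_cons_lift => -[].
exists (invmx G *m M); split.
- move=> S hS; rewrite maxminor_mulmx det_inv mulr_ge0 // invr_ge0.
  exact: (M0 B hB).
- by apply: realizes_mulmx; rewrite // det_inv invr_eq0.
- move=> i; have /matrixP /(_ i ord0) : invmx G *m G = 1%:M by rewrite mulVmx.
  by rewrite /G mulmx_colsub mxE e0 mxE => ->; rewrite mxE.
Qed.

Lemma phi_positroid (R : realType) k n PQ :
  flag_positroids R k n PQ -> positroids_ST R k.+1 n (phi PQ).
Proof.
case: PQ => P Q [[/set0Pn[B BP] _] [/set0Pn[D DQ] _] [A [/= AP AQ A0 A1]]].
have CP : realizes (homog A) (phi (P, Q)) by apply/realizes_homog; rewrite phiK.
have BR : ord0 |: (lift ord0 @: B) \in phi (P, Q) by rewrite phi1.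
have DR : lift ord0 @: D \in phi (P, Q) by rewrite phi2.
have R0 : phi (P, Q) != set0 by apply/set0Pn; exists (lift ord0 @: D).
(* Bases have [k.+1] elements; hence a minimal basis is never confused with the default [set0]. *)
have nonempty S : S \in phi (P, Q) -> S != set0.
  by case/CP => hS _; rewrite -card_gt0 hS.
split.
- split; first exact: realizes_matroid CP R0.
  by exists (homog A); split=> //; apply/nonneg_homog.
- have [Smin Sle] := lexminP R0.
  exact: lexle_ord0 (Sle _ BR) (setU11 _ _) (nonempty _ Smin).
- rewrite /T_basis; set F := [set _ in _ | _].
  have /lexminP [] : F != set0.
    by apply/set0Pn; exists (lift ord0 @: D); rewrite inE DR ord0_lift.
  by rewrite {2}/F inE => /andP[/nonempty].
Qed.

Lemma psi_flag (R : realType) k n P :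
  positroids_ST R k.+1 n P -> flag_positroids R k n (psi P).
Proof.
case=> -[[P0 _] [M [M0 MP]]] S0 T0.
(* The minimal basis contains 0 by [S0]; it serves to normalize [M] and later yields a basis of the
   first component. *)
have [SP _] := lexminP P0.
have [C [C0 CP Ce]] := positroid_normalize M0 MP SP S0.
rewrite -(dehomogK Ce) in C0 CP.
have [/realizes_homog [A1 A2] /nonneg_homog [A10 A20]] := (CP, C0).
split; last by exists (dehomog C).
  apply: realizes_matroid A1 _; apply/set0Pn.
  by exists (lift ord0 @^-1: (lexmin P :\ ord0)); rewrite psi1 setU1_lift.
apply: realizes_matroid A2 _.
(* [lexmin] of an empty family is [set0], so [T0] provides a basis avoiding 0. *)
have /set0Pn[D] : [set B in P | ord0 \notin B] != set0.
  by apply: contraNneq T0 => F0; rewrite /T_basis F0 lexmin0.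
rewrite inE => /andP[DP D0]; apply/set0Pn.
by exists (lift ord0 @^-1: D); rewrite psi2 lift_preim.
Qed.

Theorem theorem4p14 (R : realType) (k n : nat) (hkn : (k < n)%N) :
  [/\ set_bij (flag_positroids R k n) (positroids_ST R k.+1 n) (@phi n),
      set_bij (positroids_ST R k.+1 n) (flag_positroids R k n) (@psi n),
      {in flag_positroids R k n, cancel (@phi n) (@psi n)} &
      {in positroids_ST R k.+1 n, cancel (@psi n) (@phi n)}].
Proof.
split; [split|split|by move=> ? _; apply: phiK|by move=> ? _; apply: psiK].
- by move=> PQ; apply: phi_positroid.
- by move=> ? ? _ _; apply: (can_inj (@phiK n)).
- by move=> P PST; exists (psi P); [apply: psi_flag|apply: psiK].
- by move=> P; apply: psi_flag.
- by move=> ? ? _ _; apply: (can_inj (@psiK n)).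
- by move=> PQ PQf; exists (phi PQ); [apply: phi_positroid|apply: phiK].
Qed.
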